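(* There exists a weighted digraph $G$ such that adding an appendage edge to $G$ yields a weighted digraph $G'$ with $$d_I\big((H\circ\mathrm{dFl})(\mathrm{SP}(G)),\,(H\circ\mathrm{dFl})(\mathrm{SP}(G'))\big)=\infty.$$
   Context: All digraphs are simple (no self-loops; reciprocal edges allowed). A weighted digraph is $G=(V,E,w)$ with $(V,E)$ a digraph and $w:E\to(0,\infty)$. Adding an appendage edge to $G$ means adding one new vertex $c\notin V$ together with a single new weighted directed edge joining $c$ and some vertex of $G$ (leaving the rest of $G$ unchanged). A path $s_0\leadsto t_k$ is a (non-empty) sequence of edges $e_i=(s_i,t_i)$, $0\le i\le k$, with $s_{i+1}=t_i$; its length is $\sum_iw(e_i)$. The shortest-path filtration $\mathrm{SP}(G)$ is the family of digraphs $\mathrm{SP}(G)_t$, $t\in\mathbb R$, on $V(G)$, with an edge $(i,j)$, $i\ne j$, iff there is a path $i\leadsto j$ of length $\le t$; with inclusions it is a functor from the poset $(\mathbb R,\le)$ to digraphs. Fix a field $\mathbb F$. A directed $k$-clique is a $k$-tuple $v_0\dots v_{k-1}$ of distinct vertices with $v_i\to v_j$ whenever $i<j$. The directed flag complex $\mathrm{dFl}(G)$ has chain complex with basis in degree $k$ the directed $(k+1)$-cliques and $\partial(v_0\dots v_k)=\sum_i(-1)^iv_0\dots\hat{v_i}\dots v_k$ ($\partial_0=0$); $(H\circ\mathrm{dFl})(G)$ is its homology in all degrees, a graded $\mathbb F$-vector space, functorial for inclusions of digraphs. Applying this to $\mathrm{SP}(G)$ at each $t$ gives a functor from $(\mathbb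 R,\le)$ to graded vector spaces. For functors $M,N:(\mathbb R,\le)\to\mathcal C$ and $\delta\ge0$, let $M^\delta(t)=M(t+\delta)$, and let $T_M^\delta:M\Rightarrow M^\delta$ have components $M(t\le t+\delta)$. $M,N$ are $\delta$-interleaved if there are natural transformations $f:M\Rightarrow N^\delta$, $g:N\Rightarrow M^\delta$ with $g^\delta\circ f=T_M^{2\delta}$ and $f^\delta\circ g=T_N^{2\delta}$. $d_I(M,N)=\inf\{\delta\ge0:M,N\text{ are }\delta\text{-interleaved}\}\in[0,\infty]$, with $\inf\emptyset=\infty$. *)

(* Defs.v *)
From HB Require Import structures.
From mathcomp Require Import all_boot all_order all_algebra.
From mathcomp Require Import all_classical all_reals ereal interval_inference.
From mathcomp.multinomials Require Import freeg.
From mathcomp Require Import zify.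

Set Implicit Arguments.
Unset Strict Implicit.
Unset Printing Implicit Defensive.

Import Order.TTheory GRing.Theory Num.Theory.

Local Open Scope classical_set_scope.
Local Open Scope ring_scope.

Section FreegLinear.
Variables (R : nzRingType) (K : choiceType) (M : lmodType R) (f : K -> M).

Fact fglift_is_linear : linear (fglift f).
Proof.
have fgB := lift_is_additive f.
have fg0 : fglift f 0 = 0 by rewrite -(subrr 0) fgB subrr.
have fgD D1 D2 : fglift f (D1 + D2) = fglift f D1 + fglift f D2.
  by rewrite -{1}[D2]opprK fgB -[in LHS](sub0r D2) fgB fg0 sub0r opprK.
have fgZ a D : fglift f (a *: D) = a *: fglift f D.
  elim/freeg_ind_dom0: D => [|k x D _ _ IH]; first by rewrite !scaler0 fg0 scaler0.
  rewrite scalerDr !fgD IH scalerDr; congr (_ + _).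
  have -> : a *: << k *g x >> = << a * k *g x >> :> {freeg K / R}.
    by apply/eqP/freeg_eqP => y; rewrite coeffZ !coeffU mulrA.
  by rewrite !liftU scalerA.
by move=> a D1 D2; rewrite fgD fgZ.
Qed.

HB.instance Definition _ :=
  GRing.isLinear.Build R {freeg K / R} M *:%R (fglift f) fglift_is_linear.

End FreegLinear.

Section ModuleQuotient.
Local Open Scope quotient_scope.
Variables (R : nzRingType) (V : lmodType R) (P : {pred V}).

(* [P] itself, tagged by a proof that it is a submodule so that the structures
   required by [Quotient.quot] can be inferred. *)
Definition submod_pred of GRing.submod_closed P : {pred V} := P.

Hypothesis subP : GRing.submod_closed P.
Local Notation I := (submod_pred subP).
HB.instance Definition _ := GRing.isSubmodClosed.Build R V I subP.

Definition lquot := @Quotient.quot V I.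
HB.instance Definition _ := GRing.Zmodule.on lquot.

Definition lquot_class (x : V) : lquot := \pi_(@Quotient.quot V I) x.

Definition lquot_scale (a : R) (x : lquot) : lquot :=
  lquot_class (a *: repr (x : @Quotient.quot V I)).

Lemma lquot_classP (x y : V) : (lquot_class x = lquot_class y) <-> (x - y \in P).
Proof.
rewrite -[P]/I (Quotient.idealrBE I x y); split; first by move=> e; apply/eqP.
by move/eqP.
Qed.

Lemma lquot_class_surj (x : lquot) : exists y, x = lquot_class y.
Proof. by exists (repr (x : @Quotient.quot V I)); rewrite /lquot_class reprK. Qed.

Lemma lquot_classD x y : lquot_class (x + y) = lquot_class x + lquot_class y.
Proof. by rewrite /lquot_class piE. Qed.

Fact lquot_scale_class a x :
  lquot_scale a (lquot_class x) = lquot_class (a *: x).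
Proof.
rewrite /lquot_scale; apply/lquot_classP.
rewrite -scalerBr -[P]/I rpredZ //; apply/lquot_classP.
by rewrite /lquot_class reprK.
Qed.

Fact lquot_scaleA a b x : lquot_scale a (lquot_scale b x) = lquot_scale (a * b) x.
Proof.
by have [y ->] := lquot_class_surj x; rewrite !lquot_scale_class scalerA.
Qed.
Fact lquot_scale1 : left_id 1 lquot_scale.
Proof.
by move=> x; have [y ->] := lquot_class_surj x; rewrite lquot_scale_class scale1r.
Qed.
Fact lquot_scaleDr : right_distributive lquot_scale +%R.
Proof.
move=> a x y; have [x' ->] := lquot_class_surj x.
have [y' ->] := lquot_class_surj y.
by rewrite -lquot_classD !lquot_scale_class scalerDr lquot_classD.
Qed.
Fact lquot_scaleDl x : {morph lquot_scale^~ x : a b / a + b}.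
Proof.
move=> a b; have [y ->] := lquot_class_surj x.
by rewrite !lquot_scale_class scalerDl lquot_classD.
Qed.

HB.instance Definition _ := GRing.Zmodule_isLmodule.Build R lquot
  lquot_scaleA lquot_scale1 lquot_scaleDr lquot_scaleDl.

Fact lquot_class_is_linear : linear lquot_class.
Proof. by move=> a x y; rewrite lquot_classD -lquot_scale_class. Qed.
HB.instance Definition _ :=
  GRing.isLinear.Build R V lquot *:%R lquot_class lquot_class_is_linear.

End ModuleQuotient.

Section QuotientMap.
Local Open Scope quotient_scope.
Variables (R : nzRingType) (V W : lmodType R).
Variables (P : {pred V}) (Q : {pred W}).
Variables (subP : GRing.submod_closed P) (subQ : GRing.submod_closed Q).
Variables (f : {linear V -> W}) (fPQ : forall x, x \in P -> f x \in Q).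

Definition lquot_map of (forall x, x \in P -> f x \in Q) :
    lquot subP -> lquot subQ :=
  fun x => lquot_class subQ (f (repr (x : @Quotient.quot V (submod_pred subP)))).

Lemma lquot_mapE x : lquot_map fPQ (lquot_class subP x) = lquot_class subQ (f x).
Proof.
rewrite /lquot_map; apply/lquot_classP; rewrite -linearB; apply: fPQ.
by apply/lquot_classP; rewrite /lquot_class reprK.
Qed.

Fact lquot_map_is_linear : linear (lquot_map fPQ).
Proof.
move=> a x y; have [x' ->] := lquot_class_surj x.
have [y' ->] := lquot_class_surj y.
by rewrite -linearP !lquot_mapE !linearP.
Qed.
HB.instance Definition _ := GRing.isLinear.Build R (lquot subP) (lquot subQ) *:%R
  (lquot_map fPQ) lquot_map_is_linear.

End QuotientMap.
Arguments lquot_map {R V W P Q} subP subQ f fPQ x.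

Record digraph (V : choiceType) := Digraph {
  edge :> rel V;
  edge_irr : irreflexive edge
}.

Definition subdigraph (V : choiceType) (X Y : digraph V) : Prop :=
  forall i j, X i j -> Y i j.

(* Only the values of [weight] on edges are meaningful. *)
Record wdigraph (R : realType) := WDigraph {
  vertex : choiceType;
  graph :> digraph vertex;
  weight : vertex -> vertex -> R;
  weight_gt0 : forall i j, graph i j -> 0 < weight i j
}.

Section Appendage.
Variables (R : realType) (G : wdigraph R) (v : vertex G).

(* The new vertex is [None]; the new edge is [None -> v] if [from_new] holds,
   and [v -> None] otherwise. *)
Definition appendage_edge (from_new : bool) : rel (option (vertex G)) :=
  fun x y => match x, y with
  | Some a, Some b => graph G a b
  | None, Some b => from_new && (b == v)
  | Some a, None => ~~ from_new && (a == v)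
  | None, None => false
  end.

Definition appendage_weight (r : R) (x y : option (vertex G)) : R :=
  match x, y with
  | Some a, Some b => weight a b
  | _, _ => r
  end.

Fact appendage_edge_irr b : irreflexive (appendage_edge b).
Proof. by case=> //= a; rewrite edge_irr. Qed.

Fact appendage_weight_gt0 b (r : {posnum R}) i j :
  appendage_edge b i j -> 0 < appendage_weight r%:num i j.
Proof. by case: i j => [i|] [j|] //= /weight_gt0. Qed.

Definition add_appendage (from_new : bool) (r : {posnum R}) : wdigraph R :=
  WDigraph (graph := Digraph (appendage_edge_irr from_new))
           (@appendage_weight_gt0 from_new r).

End Appendage.

Record filtration (R : realType) (V : choiceType) := Filtration {
  fstage :> R -> digraph V;
  fstage_mono : forall s t, s <= t -> subdigraph (fstage s) (fstage t)
}.

Section ShortestPath.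
Variables (R : realType) (G : wdigraph R).

(* As the digraph is simple, a path [i ~> j] is encoded by [i] and the list [p]
   of the targets of its edges. *)
Fixpoint path_length (i : vertex G) (p : seq (vertex G)) : R :=
  if p is k :: p' then weight i k + path_length k p' else 0.

Definition has_path_le (t : R) (i j : vertex G) : Prop :=
  exists p : seq (vertex G),
    [/\ p <> [::], path (graph G) i p, last i p = j & path_length i p <= t].

Definition SP_edge (t : R) : rel (vertex G) :=
  fun i j => (i != j) && `[< has_path_le t i j >].

Fact SP_edge_irr t : irreflexive (SP_edge t).
Proof. by move=> i; rewrite /SP_edge eqxx. Qed.

Definition SP_stage (t : R) : digraph (vertex G) := Digraph (SP_edge_irr t).

Fact SP_mono s t : s <= t -> subdigraph (SP_stage s) (SP_stage t).
Proof.
move=> st i j /andP[ij /asboolP[p [p0 pp pj pt]]]; apply/andP; split=> //.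
by apply/asboolP; exists p; split=> //; exact: le_trans pt st.
Qed.

Definition SP : filtration R (vertex G) := Filtration SP_mono.

End ShortestPath.

Section DirectedFlag.
Variables (F : fieldType) (V : choiceType).
Implicit Types (X Y Z : digraph V) (k : nat).

Definition is_clique X k (v : {ffun 'I_k -> V}) : bool :=
  injectiveb v && [forall i : 'I_k, forall j : 'I_k, (i < j)%N ==> X (v i) (v j)].

(* The basis in degree [k]: directed [(k+1)]-cliques. *)
Definition simplex X k := {v : {ffun 'I_k.+1 -> V} | is_clique X v}.

Definition face_fun k (i : 'I_k.+2) (v : {ffun 'I_k.+2 -> V}) :
  {ffun 'I_k.+1 -> V} := [ffun j => v (fintype.lift i j)].

Fact face_clique X k (i : 'I_k.+2) (v : simplex X k.+1) :
  is_clique X (face_fun i (val v)).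
Proof.
case: v => v /= /andP[/injectiveP vI /forallP vX]; apply/andP; split.
  by apply/injectiveP => a b; rewrite !ffunE => /vI /lift_inj.
apply/forallP => a; apply/forallP => b; apply/implyP => ab; rewrite !ffunE.
have /forallP/(_ (fintype.lift i b))/implyP := vX (fintype.lift i a); apply.
by rewrite /= /bump; do 2!case: leqP; lia.
Qed.

Definition face X k (i : 'I_k.+2) (v : simplex X k.+1) : simplex X k :=
  exist _ (face_fun i (val v)) (face_clique i v).

Definition chain X k : lmodType F := {freeg (simplex X k) / F}.

Definition boundary X k : chain X k.+1 -> chain X k :=
  fglift (fun v : simplex X k.+1 =>
    \sum_(i < k.+2) << (-1) ^+ i *g face i v >> : chain X k).
HB.instance Definition _ X k := GRing.isLinear.Build F (chain X k.+1)
  (chain X k) *:%R (@boundary X k) (fglift_is_linear _).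

Definition is_cycle X k : pred (chain X k) :=
  match k return pred (chain X k) with
  | 0 => predT (* the boundary is zero in degree 0: homology is not reduced *)
  | k'.+1 => fun c => boundary c == 0
  end.

Fact is_cycle_submod X k : GRing.submod_closed (@is_cycle X k).
Proof.
case: k => [|k]; split=> //; first exact/eqP/(linear0 (@boundary X k)).
move=> a x y xc yc; have /eqP x0 : boundary x == 0 := xc.
have /eqP y0 : boundary y == 0 := yc; apply/eqP.
by rewrite linearP /= x0 y0 scaler0 addr0.
Qed.
HB.instance Definition _ X k := GRing.isSubmodClosed.Build F (chain X k)
  (@is_cycle X k) (@is_cycle_submod X k).

Definition cycles X k := {c : chain X k | is_cycle c}.
HB.instance Definition _ X k := [isSub of cycles X k for @sval _ _].
HB.instance Definition _ X k := [Choice of cycles X k by <:].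
HB.instance Definition _ X k :=
  [SubChoice_isSubZmodule of cycles X k by <:].
HB.instance Definition _ X k :=
  [SubZmodule_isSubLmodule of cycles X k by <:].

(* All of the image of [boundary] is covered, since the composite of two
   consecutive boundary maps is zero. *)
Definition is_boundary X k : pred (cycles X k) :=
  fun z => `[< exists c : chain X k.+1, val z = boundary c >].

Fact is_boundary_submod X k : GRing.submod_closed (@is_boundary X k).
Proof.
split; first by apply/asboolP; exists 0; rewrite !linear0.
move=> a x y /asboolP[c xc] /asboolP[d yd]; apply/asboolP.
by exists (a *: c + d); rewrite !linearP /= xc yd.
Qed.

Definition homology X k : lmodType F := lquot (@is_boundary_submod X k).

Section Inclusion.
Variables (X Y : digraph V) (XY : subdigraph X Y).

Fact simplex_incl_clique k (v : simplex X k) : is_clique Y (val v).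
Proof.
case: v => v /= /andP[vI /forallP vX]; apply/andP; split=> //.
apply/forallP => a; apply/forallP => b; apply/implyP => ab.
by apply: XY; have /forallP/(_ b)/implyP := vX a; exact.
Qed.

Definition simplex_incl k (v : simplex X k) : simplex Y k :=
  exist _ (val v) (simplex_incl_clique v).

Definition chain_incl k : chain X k -> chain Y k :=
  fglift (fun v : simplex X k => << simplex_incl v >> : chain Y k).
HB.instance Definition _ k := GRing.isLinear.Build F (chain X k) (chain Y k)
  *:%R (@chain_incl k) (fglift_is_linear _).

Fact boundary_incl k (c : chain X k.+1) :
  boundary (chain_incl c) = chain_incl (boundary c).
Proof.
elim/freeg_ind_dom0: c => [|a v c _ _ IH]; first by rewrite !linear0.
rewrite !linearD /= {}IH; congr (_ + _).
rewrite /boundary /chain_incl /= !liftU !linearZ /=.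
rewrite fglift_Freeg prelift_seq1 scale1r.
congr (_ *: _); rewrite linear_sum /=.
apply: eq_bigr => i _; rewrite liftU; apply/eqP/freeg_eqP => w.
rewrite coeffZ !coeffU mul1r; congr (_ * (_ == _)%:R); exact: val_inj.
Qed.

Fact chain_incl_cycle k (c : chain X k) :
  is_cycle c -> is_cycle (chain_incl c).
Proof.
case: k c => //= k c /eqP c0; apply/eqP.
by rewrite boundary_incl c0 linear0.
Qed.

Definition cycles_incl k (z : cycles X k) : cycles Y k :=
  exist _ (chain_incl (val z)) (chain_incl_cycle (valP z)).

Fact cycles_incl_is_linear k : linear (@cycles_incl k).
Proof. by move=> a x y; apply: val_inj; rewrite /= !linearP. Qed.
HB.instance Definition _ k := GRing.isLinear.Build F (cycles X k) (cycles Y k)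
  *:%R (@cycles_incl k) (@cycles_incl_is_linear k).

Fact cycles_incl_boundary k (z : cycles X k) :
  z \in @is_boundary X k -> cycles_incl z \in @is_boundary Y k.
Proof.
move=> /asboolP[c zc]; apply/asboolP.
by exists (chain_incl c); rewrite boundary_incl -zc.
Qed.

Definition homology_incl k : {linear homology X k -> homology Y k} :=
  lquot_map (@is_boundary_submod X k) (@is_boundary_submod Y k)
    (@cycles_incl k) (@cycles_incl_boundary k).

End Inclusion.

Fact chain_incl_id X (h : subdigraph X X) k (c : chain X k) :
  chain_incl h c = c.
Proof.
elim/freeg_ind_dom0: c => [|a v c _ _ IH]; first by rewrite linear0.
rewrite linearD /= {}IH; congr (_ + _); rewrite /chain_incl /= liftU.
apply/eqP/freeg_eqP => w; rewrite coeffZ !coeffU mul1r.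
by congr (_ * (_ == _)%:R); exact: val_inj.
Qed.

Fact chain_incl_comp X Y Z (h : subdigraph X Y) (h' : subdigraph Y Z)
    (h'' : subdigraph X Z) k (c : chain X k) :
  chain_incl h' (chain_incl h c) = chain_incl h'' c.
Proof.
elim/freeg_ind_dom0: c => [|a v c _ _ IH]; first by rewrite !linear0.
rewrite !linearD /= {}IH; congr (_ + _); rewrite /chain_incl /= !liftU linearZ /=.
rewrite liftU scale1r; apply/eqP/freeg_eqP => w; rewrite !coeffZ !coeffU.
by congr (_ * (_ * (_ == _)%:R)); exact: val_inj.
Qed.

Fact homology_incl_id X (h : subdigraph X X) k (x : homology X k) :
  homology_incl h k x = x.
Proof.
have [z ->] := lquot_class_surj x; rewrite /homology_incl /= lquot_mapE.
by congr lquot_class; apply: val_inj; exact: chain_incl_id.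
Qed.

Fact homology_incl_comp X Y Z (h : subdigraph X Y) (h' : subdigraph Y Z)
    (h'' : subdigraph X Z) k (x : homology X k) :
  homology_incl h' k (homology_incl h k x) = homology_incl h'' k x.
Proof.
have [z ->] := lquot_class_surj x; rewrite /homology_incl /= !lquot_mapE.
by congr lquot_class; apply: val_inj; exact: chain_incl_comp.
Qed.

End DirectedFlag.

(* A functor from the poset (R, <=) to graded vector spaces over [F], with
   degree-preserving linear maps as morphisms. *)
Record pgvect (R : realType) (F : fieldType) := PGVect {
  pobj :> R -> nat -> lmodType F;
  pmap : forall s t, s <= t -> forall k, {linear pobj s k -> pobj t k};
  pmap_id : forall s (h : s <= s) k (x : pobj s k), pmap h k x = x;
  pmap_comp : forall s t u (st : s <= t) (tu : t <= u) (su : s <= u) k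
    (x : pobj s k), pmap tu k (pmap st k x) = pmap su k x
}.

Definition HdFl (R : realType) (F : fieldType) (V : choiceType)
    (X : filtration R V) : pgvect R F :=
  @PGVect R F (fun t => homology F (X t))
    (fun s t st => homology_incl F (fstage_mono (f := X) st))
    (fun s h => @homology_incl_id F V _ _)
    (fun s t u st tu su => @homology_incl_comp F V _ _ _ _ _ _).

Section Interleaving.
Variables (R : realType) (F : fieldType).
Implicit Types (M N : pgvect R F) (d : {nonneg R}).

Fact shift_le d (s t : R) : s <= t -> s + d%:num <= t + d%:num.
Proof. by rewrite lerD2r. Qed.

Definition shift M d : pgvect R F :=
  @PGVect R F (fun t => M (t + d%:num))
    (fun s t st => pmap M (shift_le d st))
    (fun s h => @pmap_id _ _ M _ _)
    (fun s t u st tu su => @pmap_comp _ _ M _ _ _ _ _ _).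

Record nat_trans M N := NatTrans {
  ntcomp :> forall t k, {linear M t k -> N t k};
  nt_natural : forall s t (st : s <= t) k (x : M s k),
    ntcomp t k (pmap M st k x) = pmap N st k (ntcomp s k x)
}.

Fact shift2_le d (t : R) : t <= t + d%:num + d%:num.
Proof. by rewrite -addrA lerDl addr_ge0. Qed.

(* The [2d]-shift of [M] is taken to be [shift (shift M d) d], whose value at [t]
   is [M (t + d + d)]. *)
Definition interleaved d M N : Prop :=
  exists (f : nat_trans M (shift N d)) (g : nat_trans N (shift M d)),
    (forall t k (x : M t k),
       g (t + d%:num) k (f t k x) = pmap M (shift2_le d t) k x) /\
    (forall t k (y : N t k),
       f (t + d%:num) k (g t k y) = pmap N (shift2_le d t) k y).

Definition interleaving_distance M N : \bar R :=
  ereal_inf [set (d%:num)%:E | d in [set d : {nonneg R} | interleaved d M N]].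

End Interleaving.

(* Main.v *)
Require Import Defs.
From HB Require Import structures.
From mathcomp Require Import all_boot all_order all_algebra.
From mathcomp Require Import all_classical all_reals ereal interval_inference.
From mathcomp.multinomials Require Import freeg.

(** Let [G] consist of two vertices joined by a pair of reciprocal edges.  From
some time on, [SP G] is the complete digraph on these vertices, whose directed
flag complex is a circle: two vertices and two arcs.  Having no 2-simplices, it
carries a class in H_1 that never dies ([digon_class_neq0]).

Now let an appendage edge point from a new vertex [c] into [G].  As [G] is
strongly connected, paths of bounded length eventually lead from [c] to every
vertex, while no path ever leads into [c].  So eventually each directed clique
avoiding [c] extends, uniquely, by putting [c] in front: the directed flag
complex becomes a cone, and its homology in positive degrees vanishes
([homology_apex_eq0]).

An interleaving, for whatever [d], would factor the nonzero image of the circle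
class at time [t + 2d] through the zero space at time [t + d]; hence there is
none, and the distance is infinite ([interleaving_distance_pinfty]). *)

Set Implicit Arguments.
Unset Strict Implicit.
Unset Printing Implicit Defensive.

Import Order.TTheory GRing.Theory Num.Theory.

Local Open Scope classical_set_scope.
Local Open Scope ring_scope.

(** * Interleavings and classes that persist forever *)

Lemma interleaving_distance_pinfty (R : realType) (F : fieldType)
    (M N : pgvect R F) (t0 : R) (k : nat) (x : M t0 k) :
    (forall t (h : t0 <= t), Defs.pmap M h k x <> 0) ->
    (forall t, t0 <= t -> forall y : N t k, y = 0) ->
  interleaving_distance M N = +oo%E.
Proof.
move=> x_neq0 N0; rewrite /interleaving_distance.
set D := (X in ereal_inf X); suff -> : D = set0 by exact: ereal_inf0.
rewrite -subset0 => e [d [f [g [gf _]]] _].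
exfalso; apply: (x_neq0 _ (shift2_le d t0)); rewrite -gf.
rewrite (N0 _ _ (f t0 k x)) ?linear0 //.
by rewrite lerDl.
Qed.

(** * Cones *)

Section Cone.
Variables (F : fieldType) (V : choiceType) (X : digraph V) (c : V).

Definition prepend k (v : {ffun 'I_k -> V}) : {ffun 'I_k.+1 -> V} :=
  [ffun i => oapp v c (unlift ord0 i)].

Lemma prepend0 k (v : {ffun 'I_k -> V}) : prepend v ord0 = c.
Proof. by rewrite ffunE unlift_none. Qed.

Lemma prepend_lift k (v : {ffun 'I_k -> V}) i :
  prepend v (fintype.lift ord0 i) = v i.
Proof. by rewrite ffunE liftK. Qed.

(** Cliques that already contain [c] are sent to zero: prepending [c] to them
does not give a clique. *)
Definition cone_simplex k (v : simplex X k) : chain F X k.+1 :=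
  if insub (prepend (val v)) is Some w then << (w : simplex X k.+1) >> else 0.

Definition cone k : chain F X k -> chain F X k.+1 := fglift (@cone_simplex k).
HB.instance Definition _ k := GRing.isLinear.Build F (chain F X k)
  (chain F X k.+1) *:%R (@cone k) (fglift_is_linear _).

Lemma chain_basisE k a (v : simplex X k) :
  << a *g v >> = a *: << v >> :> chain F X k.
Proof. by apply/eqP/freeg_eqP => y; rewrite coeffZ !coeffU mul1r. Qed.

Lemma coneU k a (v : simplex X k) :
  cone (<< a *g v >> : chain F X k) = a *: cone_simplex v.
Proof. exact: liftU. Qed.

Lemma boundaryU k a (v : simplex X k.+1) :
  boundary (<< a *g v >> : chain F X k.+1) =
  a *: \sum_(i < k.+2) (<< (-1) ^+ i *g face i v >> : chain F X k).
Proof. exact: liftU. Qed.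

Lemma face0_prepend k (v : {ffun 'I_k.+1 -> V}) :
  face_fun ord0 (prepend v) = v.
Proof. by apply/ffunP => i; rewrite ffunE prepend_lift. Qed.

Lemma face_lift_prepend k (i : 'I_k.+2) (v : {ffun 'I_k.+2 -> V}) :
  face_fun (fintype.lift ord0 i) (prepend v) = prepend (face_fun i v).
Proof.
apply/ffunP => j; rewrite [LHS]ffunE.
case: (unliftP ord0 j) => [l ->|->].
  rewrite prepend_lift [RHS]ffunE -(prepend_lift v); congr (prepend v _).
  by apply: val_inj; rewrite /= /bump /= !add1n ltnS addnS.
by rewrite prepend0 -[RHS](prepend0 v); congr (prepend v _); apply: val_inj.
Qed.

Lemma prepend_face0 k (v : {ffun 'I_k.+2 -> V}) :
  v ord0 = c -> prepend (face_fun ord0 v) = v.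
Proof.
move=> v0; apply/ffunP => j; case: (unliftP ord0 j) => [l ->|->].
  by rewrite prepend_lift ffunE.
by rewrite prepend0.
Qed.

Hypothesis apex_to : forall x, x != c -> X c x.
Hypothesis no_edge_to_apex : forall x, ~~ X x c.

Lemma prepend_clique k (v : simplex X k) :
  is_clique X (prepend (val v)) = (val v ord0 != c).
Proof.
apply/idP/idP => [/andP[/injectiveP inj _]|v0].
  apply/eqP => v0; have := inj (fintype.lift ord0 ord0) ord0.
  by rewrite prepend0 prepend_lift v0 => /(_ erefl).
have /andP[/injectiveP vI /forallP vX] := valP v.
(* An edge would join the first vertex to any later occurrence of the apex. *)
have vc i : val v i != c.
  case: (posnP i) => [i0|i_gt0]; first by rewrite (_ : i = ord0) //; exact: val_inj.
  apply/eqP => vi; have /forallP/(_ i)/implyP/(_ i_gt0) := vX ord0.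
  by rewrite vi (negbTE (no_edge_to_apex _)).
apply/andP; split.
  apply/injectiveP => i j.
  case: (unliftP ord0 i) => [i' ->|->]; case: (unliftP ord0 j) => [j' ->|->] //;
    rewrite ?prepend0 ?prepend_lift.
  - by move/vI->.
  - by move=> e; move: (vc i'); rewrite e eqxx.
  - by move=> e; move: (vc j'); rewrite -e eqxx.
apply/forallP => i; apply/forallP => j; apply/implyP.
case: (unliftP ord0 i) => [i' ->|->]; case: (unliftP ord0 j) => [j' ->|->] //;
  rewrite ?prepend0 ?prepend_lift.
- rewrite /= /bump /= !add1n ltnS => ij.
  by have /forallP/(_ j')/implyP := vX i'; exact.
- by move=> _; exact: apex_to.
Qed.

Lemma cone_simplex_eq0 k (v : simplex X k) :
  val v ord0 = c -> cone_simplex v = 0.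
Proof. by move=> v0; rewrite /cone_simplex insubF // prepend_clique v0 eqxx. Qed.

Lemma cone_simplexE k (v : simplex X k) (w : simplex X k.+1) :
  val w = prepend (val v) -> cone_simplex v = << w >>.
Proof.
move=> wv; rewrite /cone_simplex -wv.
by rewrite (_ : insub (val w) = Some w) //; exact: valK.
Qed.

(** Coning off is a contracting homotopy.  On a clique avoiding the apex, the
zeroth face of the cone is the clique itself and the other faces are the cones
over its faces; on a clique starting with the apex, only the zeroth face has a
nonzero cone, which is the clique itself. *)
Lemma cone_homotopy k (x : chain F X k.+1) :
  boundary (cone x) + cone (boundary x) = x.
Proof.
elim/freeg_ind_dom0: x => [|a v x _ _ IH]; first by rewrite !linear0 addr0.
rewrite !linearD /= addrACA {}IH; congr (_ + _).
rewrite coneU boundaryU !linearZ /= linear_sum /= -scalerDr.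
rewrite [in RHS]chain_basisE; congr (_ *: _).
rewrite (eq_bigr (fun i : 'I_k.+2 => (-1) ^+ i *: cone_simplex (face i v)));
  last by move=> i _; rewrite coneU.
have [v0|v0] := eqVneq (val v ord0) c.
  rewrite cone_simplex_eq0 // linear0 add0r big_ord_recl /= expr0 scale1r.
  rewrite (@cone_simplexE _ (face ord0 v) v) ?prepend_face0 //.
  rewrite big1 ?addr0 // => i _.
  rewrite cone_simplex_eq0 ?scaler0 //= ffunE -v0.
  by congr (val v _); apply: val_inj.
have w_clique : is_clique X (prepend (val v)) by rewrite prepend_clique.
pose w : simplex X k.+2 := Sub (prepend (val v)) w_clique.
rewrite (@cone_simplexE _ v w) // boundaryU scale1r big_ord_recl /= expr0.
have -> : face ord0 w = v by apply: val_inj; exact: face0_prepend.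
rewrite -addrA -big_split /= big1 ?addr0 // => i _.
have face_w : val (face (fintype.lift ord0 i) w) = prepend (val (face i v)).
  exact: face_lift_prepend.
rewrite (cone_simplexE face_w) /bump leq0n add1n exprS mulN1r.
apply/eqP/freeg_eqP => y.
by rewrite coeffD coeffZ !coeffU coeff0 mul1r mulNr addNr.
Qed.

Lemma homology_apex_eq0 k (x : homology F X k.+1) : x = 0.
Proof.
have [z ->] := lquot_class_surj x.
rewrite -(linear0 (lquot_class (@is_boundary_submod F _ X k.+1))).
apply/lquot_classP; rewrite subr0; apply/asboolP; exists (cone (val z)).
rewrite -[LHS]cone_homotopy.
have /eqP -> : boundary (val z) == 0 := valP z.
by rewrite linear0 addr0.
Qed.

End Cone.

(** * The circle carried by two reciprocal edges *)

Section Digon.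
Variables (F : fieldType) (V : choiceType).

Definition vertex_fun (a : V) : {ffun 'I_1 -> V} := [ffun => a].

Fact vertex_clique (X : digraph V) a : is_clique X (vertex_fun a).
Proof.
apply/andP; split; first by apply/injectiveP => i j; rewrite !ord1.
by apply/forallP => i; apply/forallP => j; rewrite !ord1.
Qed.

Definition vertex_simplex (X : digraph V) a : simplex X 0 :=
  Sub (vertex_fun a) (vertex_clique X a).

Definition arc_fun (a b : V) : {ffun 'I_2 -> V} :=
  [ffun i => if i == ord0 then a else b].

Fact arc_clique (X : digraph V) a b : X a b -> is_clique X (arc_fun a b).
Proof.
move=> Xab; have ab : a != b by apply: contraTneq Xab => ->; rewrite edge_irr.
apply/andP; split.
  apply/injectiveP => -[[|[|//]] hi] [[|[|//]] hj]; rewrite !ffunE /= => e.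
  - exact: val_inj.
  - by rewrite e eqxx in ab.
  - by rewrite e eqxx in ab.
  - exact: val_inj.
apply/forallP => -[[|[|//]] ?]; apply/forallP => -[[|[|//]] ?];
  by rewrite !ffunE.
Qed.

Definition arc (X : digraph V) a b (Xab : X a b) : simplex X 1 :=
  Sub (arc_fun a b) (arc_clique Xab).

Lemma boundary_arc (X : digraph V) a b (Xab : X a b) :
  boundary (<< arc Xab >> : chain F X 1) =
  << vertex_simplex X b >> - << vertex_simplex X a >>.
Proof.
rewrite boundaryU scale1r big_ord_recl big_ord1.
have -> : face ord0 (arc Xab) = vertex_simplex X b.
  by apply: val_inj; apply/ffunP => i; rewrite !ffunE.
have -> : face (fintype.lift ord0 ord0) (arc Xab) = vertex_simplex X a.
  by apply: val_inj; apply/ffunP => i; rewrite !ffunE; case: i => [[]].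
by rewrite expr0 [X in _ + X]chain_basisE /= expr1 scaleN1r.
Qed.

Variables (X : digraph V) (a b : V) (Xab : X a b) (Xba : X b a).

Definition digon_chain : chain F X 1 := << arc Xab >> + << arc Xba >>.

Fact digon_is_cycle : is_cycle digon_chain.
Proof. by apply/eqP; rewrite linearD /= !boundary_arc subrKA subrr. Qed.

Definition digon_cycle : cycles F X 1 := exist _ digon_chain digon_is_cycle.

Definition digon_class : homology F X 1 :=
  lquot_class (@is_boundary_submod F V X 1) digon_cycle.

(** Without 2-simplices there are no boundaries to kill the class, so it is
enough that the chain is nonzero; its two arcs are different simplices and do
not cancel in any characteristic. *)
Lemma digon_class_neq0 (Y : digraph V) (XY : subdigraph X Y) :
  (simplex Y 2 -> False) -> homology_incl F XY 1 digon_class <> 0.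
Proof.
move=> Y2; rewrite /homology_incl /= lquot_mapE.
rewrite -(linear0 (lquot_class (@is_boundary_submod F _ Y 1))).
move/lquot_classP; rewrite subr0 => /asboolP[d].
have -> : boundary d = 0.
  by elim/freeg_ind_dom0: d => [|? v]; [rewrite linear0 | case: (Y2 v)].
move=> /(congr1 (coeff (simplex_incl XY (arc Xab)))).
rewrite /= /digon_chain linearD /= /chain_incl !liftU !scale1r.
rewrite coeffD !coeffU coeff0 !mul1r eqxx.
suff /negbTE -> : simplex_incl XY (arc Xba) != simplex_incl XY (arc Xab).
  by move/eqP; rewrite addr0 oner_eq0.
apply/eqP => /(congr1 val)/ffunP/(_ ord0); rewrite !ffunE /= => ba.
by have := Xab; rewrite ba edge_irr.
Qed.

End Digon.

Lemma no_bool_2simplex (X : digraph bool) : simplex X 2 -> False.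
Proof.
case=> v /andP[/injectiveP vI _].
by have := leq_card v vI; rewrite card_ord card_bool.
Qed.

(** * Shortest-path filtrations *)

Section ShortPaths.
Variables (R : realType) (G : wdigraph R).

Lemma SP_intro (t : R) (i j : vertex G) (p : seq (vertex G)) :
    i != j -> p != [::] -> path (graph G) i p -> last i p = j ->
    path_length i p <= t ->
  SP G t i j.
Proof.
by move=> ij /eqP p0 ? ? ?; rewrite /= /SP_edge ij; apply/asboolP; exists p.
Qed.

Lemma SP_no_edge_to (t : R) (c : vertex G) :
  (forall x, ~~ G x c) -> forall x, ~~ SP G t x c.
Proof.
move=> Gc x; apply/negP => /andP[_ /asboolP[p [p0 pp pc _]]].
case/lastP: p p0 pp pc => // p y _; rewrite rcons_path last_rcons => /andP[_ e] yc.
by move: e; rewrite yc (negbTE (Gc _)).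
Qed.

End ShortPaths.

Fact digon_irr : irreflexive (fun a b : bool => a != b).
Proof. by move=> a; rewrite eqxx. Qed.

Definition digon (R : realType) : wdigraph R :=
  @WDigraph R bool (Digraph digon_irr) (fun _ _ => 1) (fun _ _ _ => ltr01).

Lemma SP_digon (R : realType) (t : R) (a b : bool) :
  1 <= t -> a != b -> SP (digon R) t a b.
Proof.
by move=> t1 ab; apply: (SP_intro (p := [:: b : vertex (digon R)]));
  rewrite //= ?ab ?addr0.
Qed.

Lemma SP_appendage_apex (R : realType) (r : {posnum R}) (t : R)
    (x : option bool) :
    r%:num + 1 <= t -> x != None ->
  SP (add_appendage (true : vertex (digon R)) true r) t None x.
Proof.
set G' := add_appendage _ _ _; move=> rt; case: x => // b _.
case: b.
  apply: (SP_intro (p := [:: Some true : vertex G'])) => //=.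
  by rewrite addr0 (le_trans _ rt) // lerDl.
by apply: (SP_intro (p := [:: Some true; Some false] : seq (vertex G')));
  rewrite //= addr0.
Qed.

Theorem proposition6p12 (R : realType) (F : fieldType) :
  exists (G : wdigraph R) (v : vertex G) (from_new : bool) (r : {posnum R}%R),
    interleaving_distance (HdFl F (SP G))
      (HdFl F (SP (add_appendage v from_new r))) = (+oo)%E.
Proof.
pose r : {posnum R} := PosNum ltr01.
exists (digon R), true, true, r.
have le_1r : 1 <= r%:num + 1 by rewrite lerDr.
have tf : SP (digon R) (r%:num + 1) true false by exact: SP_digon.
have ft : SP (digon R) (r%:num + 1) false true by exact: SP_digon.
(* From time [r + 1] on, the new vertex reaches both vertices of the digon: the
   path to the further one uses the appendage edge and one edge of the digon. *)
apply: (@interleaving_distance_pinfty _ _ (HdFl F (SP (digon R))) _ (r%:num + 1)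
  1%N (digon_class F tf ft)).
  by move=> t rt; apply: digon_class_neq0; exact: no_bool_2simplex.
move=> t rt y; apply: (homology_apex_eq0 (c := None)) y.
  by move=> x; exact: SP_appendage_apex.
by apply: (@SP_no_edge_to R (add_appendage _ true r) t None) => -[].
Qed.
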